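(* For every integer $n\ge 9$, $$ex^{con}_3(n;P^3_3|C^3_3)=3n-8.$$
   Context: A 3-graph is a pair $H=(V,E)$ with $V$ a finite set and $E\subseteq\binom V3$ (the edges). A 3-graph is $F$-free if it contains no subhypergraph isomorphic to $F$ (not necessarily induced). A 3-graph is connected if its vertex set cannot be partitioned into two nonempty parts so that every edge is contained in one of the parts (in particular, a connected 3-graph with more than one vertex has no isolated vertices). $P^3_3$ is the linear path of length 3: the 3-graph with three edges $e_1,e_2,e_3$ such that $|e_1\cap e_2|=|e_2\cap e_3|=1$ and $e_1\cap e_3=\emptyset$ (7 vertices). $C^3_3$ is the triangle: the 3-graph on 6 vertices $a,b,c,d,e,f$ with the three edges $\{a,b,c\},\{c,d,e\},\{e,f,a\}$. $ex^{con}_3(n;P^3_3|C^3_3)$ denotes the largest number of edges in a connected $n$-vertex $P^3_3$-free 3-graph that contains a copy of $C^3_3$ as a subhypergraph. *)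

(* Defs.v *)
From HB Require Import structures.
From mathcomp Require Import all_boot.

Set Implicit Arguments.
Unset Strict Implicit.
Unset Printing Implicit Defensive.

Section ThreeGraph.
Variable V : finType.

Record tgraph := TGraph {
  edges : {set {set V}};
  _ : [forall e in edges, #|e| == 3] }.

HB.instance Definition _ := [isSub for edges].
HB.instance Definition _ := [Finite of tgraph by <:].

Definition connected (H : tgraph) : bool :=
  ~~ [exists A : {set V}, [&& A != set0, ~: A != set0 &
        [forall e in edges H, (e \subset A) || (e \subset ~: A)]]].

End ThreeGraph.

(* H has a (not necessarily induced) subhypergraph isomorphic to F; the
   injection f is the isomorphism from F onto that subhypergraph. *)
Definition contains (U V : finType) (F : tgraph U) (H : tgraph V) : bool :=
  [exists f : {ffun U -> V},
     injectiveb f && [forall e in edges F, f @: e \in edges H]].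

Definition free (U V : finType) (F : tgraph U) (H : tgraph V) : bool :=
  ~~ contains F H.

Definition triple (n i j k : nat) : {set 'I_n} :=
  [set x : 'I_n | (x : nat) \in [:: i; j; k]].

Lemma card_triple n i j k :
  i < n -> j < n -> k < n -> uniq [:: i; j; k] -> #|triple n i j k| == 3.
Proof.
move=> hi hj hk; rewrite /= !inE negb_or andbT => /andP[/andP[ij ik] jk].
suff -> : triple n i j k = [set Ordinal hi; Ordinal hj; Ordinal hk].
  by rewrite -setUA cardsU1 cards2 !inE -!val_eqE /= negb_or ij ik jk.
by apply/setP => x; rewrite !inE -!val_eqE /= orbA.
Qed.

Definition P33_edges : {set {set 'I_7}} :=
  [set triple 7 0 1 2; triple 7 2 3 4; triple 7 4 5 6].

Lemma P33_uniform : [forall e in P33_edges, #|e| == 3].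
Proof.
apply/forall_inP => e; rewrite !inE -orbA.
by case/or3P => /eqP ->; apply: card_triple.
Qed.

Definition P33 : tgraph 'I_7 := TGraph P33_uniform.

Definition C33_edges : {set {set 'I_6}} :=
  [set triple 6 0 1 2; triple 6 2 3 4; triple 6 4 5 0].

Lemma C33_uniform : [forall e in C33_edges, #|e| == 3].
Proof.
apply/forall_inP => e; rewrite !inE -orbA.
by case/or3P => /eqP ->; apply: card_triple.
Qed.

Definition C33 : tgraph 'I_6 := TGraph C33_uniform.

(* The largest number of edges of a connected F-free 3-graph on n vertices
   (taken, up to isomorphism, to be 'I_n) containing a copy of G.  By the
   convention on empty maxima it is 0 when there is no such 3-graph. *)
Definition ex_con (U W : finType) (n : nat) (F : tgraph U) (G : tgraph W) : nat :=
  \max_(H : tgraph 'I_n | [&& connected H, free F H & contains G H])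
     #|edges H|.

(* Main.v *)
Require Import Defs.
From mathcomp Require Import all_boot.
From mathcomp Require Import zify.

(** Extremal 3-graph: all triples meeting a fixed 3-set K in at least two
    vertices.  There are 1 + 3 (n - 3) of them, they contain a triangle whose
    three pairwise intersections are the vertices of K, and no two of them are
    disjoint, which excludes the linear path.

    For the upper bound fix a triangle with edges T_i = {y_i, x_j, x_k}
    ({i, j, k} = {0, 1, 2}) and vertex set U, and let W be the complement of U.
    - An edge that leaves U but meets it is {w} together with either a core
      pair {x_j, x_k} or a spike pair {x_i, y_i}, with w in W: anything else
      starts a linear path that ends in the triangle ([edge_leaving]).  The
      same argument shows that no edge disjoint from U touches such an edge
      ([edge_meets_U]), so connectedness forces every edge to meet U
      ([edge_meets]) and every vertex of W to carry at least one pair.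
    - Spikes at one vertex of W restrict the pairs at all the others
      ([spike_spike], [spike_core]), so that the edges leaving U number at most
      3 |W| ([outer_sum]): a vertex of W carrying more than three pairs makes
      the other vertices carry correspondingly fewer.
    - The 20 triples of U split into 10 complementary pairs.  An edge {w, p, q}
      leaving U bridges two complementary edges separated by p and q, and a
      linear path through an edge of the triangle excludes nearly all other
      complementary pairs of edges: a spike excludes all of them
      ([complementary_spike]), and the core pair {x_j, x_k} all but T_i and its
      complement ([complementary_core]).  Hence at most 10 edges lie inside U
      if a spike or two different core pairs occur, and at most 11 otherwise.

    In the first case the total is at most 10 + 3 |W|.  In the second every
    vertex of W carries the same single pair, and the total is at most
    11 + |W|.  With |W| = n - 6 both are at most 3 n - 8. *)

Set Implicit Arguments.
Unset Strict Implicit.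
Unset Printing Implicit Defensive.

(** * Triples and indices *)

Lemma disjoint_set3 (T : finType) (a b c : T) (B : {set T}) :
  [disjoint [set a; b; c] & B] = [&& a \notin B, b \notin B & c \notin B].
Proof. by rewrite disjoints_subset !subUset !sub1set !inE andbA. Qed.

Lemma set3_rot (T : finType) (a b c : T) : [set a; b; c] = [set b; c; a].
Proof. by rewrite -setUA setUC. Qed.

Lemma card3_set3 (T : finType) (e : {set T}) (p q : T) :
  #|e| = 3 -> p \in e -> q \in e -> p != q ->
  exists z, [/\ e = [set p; q; z], z != p & z != q].
Proof.
move=> e3 pe qe pq.
have /cards1P[z ez] : #|e :\ p :\ q| == 1.
  by have := cardsD1 p e; have := cardsD1 q (e :\ p); rewrite !inE pe qe eq_sym pq e3; lia.
have : z \in e :\ p :\ q by rewrite ez set11.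
rewrite !inE => /and3P[zq zp ze]; exists z; split=> //.
rewrite -{1}(setD1K pe) -(setD1K (_ : q \in e :\ p)) ?ez ?setUA //.
by rewrite !inE eq_sym pq.
Qed.

Lemma card3_setU1 (T : finType) (e : {set T}) (p : T) :
  #|e| = 3 -> p \in e ->
  exists a b, [/\ e = p |: [set a; b], a != b, a != p & b != p].
Proof.
move=> e3 pe; have : #|e :\ p| == 2 by have := cardsD1 p e; rewrite pe e3; lia.
case/cards2P => a [b [ab E]]; exists a, b.
have : (a \in e :\ p) && (b \in e :\ p) by rewrite E !inE !eqxx orbT.
by rewrite !inE -andbA => /and4P[-> _ -> _]; rewrite -E setD1K.
Qed.

Lemma third_index (i j : 'I_3) : i != j -> exists k, uniq [:: i; j; k].
Proof.
move=> ij; have /card_gt0P[k] : 0 < #|~: [set i; j]|.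
  by rewrite cardsCs setCK cards2 ij card_ord.
rewrite !inE negb_or => /andP[ki kj]; exists k.
by rewrite /= !inE negb_or ij eq_sym ki eq_sym kj.
Qed.

Lemma index_cases (i j k l : 'I_3) :
  uniq [:: i; j; k] -> [\/ l = i, l = j | l = k].
Proof.
move=> u; have : l \in [:: i; j; k].
  have sub : {subset [:: i; j; k] <= enum 'I_3} by move=> m _; rewrite mem_enum.
  have [|_ ->] := uniq_min_size u sub; first by rewrite size_enum_ord.
  by rewrite mem_enum.
by rewrite !inE => /or3P[] /eqP ->; [constructor 1|constructor 2|constructor 3].
Qed.

Lemma index_rest (i : 'I_3) : exists j k, uniq [:: i; j; k].
Proof.
have /card_gt0P[j] : 0 < #|~: [set i]| by rewrite cardsCs setCK cards1 card_ord.
by rewrite !inE eq_sym => /third_index[k u]; exists j, k.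
Qed.

Lemma index_neqE (i j k : 'I_3) : uniq [:: i; j; k] ->
  ((i == j) = false) * ((i == k) = false) * ((j == k) = false) *
  ((j == i) = false) * ((k == i) = false) * ((k == j) = false).
Proof.
rewrite /= !inE negb_or !andbT => /andP[/andP[/negPf ij /negPf ik] /negPf jk].
by do ![split]; rewrite // eq_sym.
Qed.

Lemma uniq_index_perm (i j k : 'I_3) :
  uniq [:: i; j; k] -> uniq [:: j; i; k] /\ uniq [:: j; k; i].
Proof.
by move=> u; rewrite /= !inE !(index_neqE u).
Qed.

Lemma triple_ord n i j k (hi : i < n) (hj : j < n) (hk : k < n) :
  triple n i j k = [set Ordinal hi; Ordinal hj; Ordinal hk].
Proof. by apply/setP => x; rewrite !inE -!val_eqE /= orbA. Qed.

Lemma imset_triple n (T : finType) (f : 'I_n -> T) i j k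
    (hi : i < n) (hj : j < n) (hk : k < n) :
  f @: triple n i j k = [set f (Ordinal hi); f (Ordinal hj); f (Ordinal hk)].
Proof. by rewrite triple_ord !imsetU !imset_set1. Qed.

Lemma card_edge (V : finType) (H : tgraph V) e : e \in edges H -> #|e| = 3.
Proof. by case: H => E /= /forall_inP h /h /eqP. Qed.

(** * Linear paths *)

Lemma free_linear_path (V : finType) (H : tgraph V) (a b c d e f g : V) :
  free P33 H -> uniq [:: a; b; c; d; e; f; g] ->
  [set a; b; c] \in edges H -> [set c; d; e] \in edges H ->
  [set e; f; g] \notin edges H.
Proof.
move=> /existsPn/= fr u h1 h2; apply/negP => h3.
have := fr [ffun i : 'I_7 => nth a [:: a; b; c; d; e; f; g] i].
apply/negP/negPn/andP; split.
  apply/injectiveP => i j; rewrite !ffunE => /eqP.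
  by rewrite nth_uniq // => /eqP/val_inj.
apply/forall_inP => A; rewrite !inE -orbA.
by case/or3P => /eqP ->; rewrite imset_triple // => *; rewrite !ffunE.
Qed.

(** The linear path seen from its middle edge: two disjoint edges cannot be
    joined by an edge with one vertex in each and the third in neither.  The
    free vertices of the outer edges then need no names. *)
Lemma free_bridge (V : finType) (H : tgraph V) (e1 e3 : {set V}) (p q z : V) :
  free P33 H -> e1 \in edges H -> e3 \in edges H -> [disjoint e1 & e3] ->
  p \in e1 -> q \in e3 -> z \notin e1 -> z \notin e3 ->
  [set p; q; z] \notin edges H.
Proof.
move=> fr h1 h3 dis pe qe z1 z3; apply/negP => h2.
have dE : forall u v, u \in e1 -> v \in e3 -> u != v.
  move=> u v ue ve; apply/eqP => uv; rewrite uv in ue.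
  by have := disjointFr dis ue; rewrite ve.
have [a [b [E1 ab ap bp]]] := card3_setU1 (card_edge h1) pe.
have [f [g [E3 fg fq gq]]] := card3_setU1 (card_edge h3) qe.
suff : [set q; f; g] \notin edges H by rewrite E3 !setUA in h3 *; rewrite h3.
apply: (@free_linear_path _ _ a b p z q f g) => //; last 1 first.
- by rewrite setUAC.
- have ne1 u : u \in e1 -> u != z by move=> ue; apply: contraNneq z1 => <-.
  have ne3 u : u \in e3 -> z != u by move=> ue; apply: contraNneq z3 => ->.
  have [a1 b1] : a \in e1 /\ b \in e1 by rewrite E1 !inE !eqxx !orbT.
  have [f3 g3] : f \in e3 /\ g \in e3 by rewrite E3 !inE !eqxx !orbT.
  rewrite /= !inE !negb_or ab ap bp fg (eq_sym q f) fq (eq_sym q g) gq /=.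
  by do ?[apply/andP; split] => //; by [exact: dE | exact: ne1 | exact: ne3].
- by rewrite setUC -E1.
Qed.

(** * The triangle and the edges leaving it *)

(** The pair of core vertices other than [x i]; adding [y i] gives the edge of
    the triangle opposite to [x i]. *)
Definition core_pair (V : finType) (x : 'I_3 -> V) (i : 'I_3) : {set V} :=
  x @: [set~ i].

Definition spike_pair (V : finType) (x y : 'I_3 -> V) (i : 'I_3) : {set V} :=
  [set x i; y i].

Section Triangle.

Variables (V : finType) (H : tgraph V) (x y : 'I_3 -> V).
Hypotheses (x_inj : injective x) (y_inj : injective y).
Hypothesis xy : forall i j, x i != y j.
Hypothesis tri : forall i, y i |: core_pair x i \in edges H.
Hypothesis Hfree : free P33 H.

Local Notation E := (edges H).
Local Notation core := (core_pair x).
Local Notation spike := (spike_pair x y).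
Let U := [set x i | i in 'I_3] :|: [set y i | i in 'I_3].
Let cores w := [set i | w |: core i \in E].
Let spikes w := [set i | w |: spike i \in E].

(** With [outsideE] and [index_neqE], decides every membership and equality
    between the named vertices, so that the hypotheses of [bridge] are checked
    by rewriting. *)
Lemma vertexE :
  ((forall i j, (x i == x j) = (i == j)) * (forall i j, (y i == y j) = (i == j)) *
   (forall i j, (x i == y j) = false) * (forall i j, (y i == x j) = false) *
   (forall i j, (x j \in core i) = (j != i)) *
   (forall i j, (y j \in core i) = false))%type.
Proof.
have yx i j : (y i == x j) = false by rewrite eq_sym (negPf (xy j i)).
do ![split] => i j; rewrite ?(inj_eq x_inj) ?(inj_eq y_inj) ?yx ?(negPf (xy i j)) //.
  by rewrite mem_imset // !inE.
by apply/imsetP => -[k _ /eqP]; rewrite yx.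
Qed.

Lemma coreE i j k : uniq [:: i; j; k] -> core i = [set x j; x k].
Proof.
move=> u; rewrite /core_pair; have -> : [set~ i] = [set j; k].
  apply/setP => l; rewrite !inE; move: u (index_cases l u) => /=.
  rewrite !inE negb_or !andbT => /andP[/andP[ij ik] jk].
  by case=> ->; rewrite eqxx ?orbT ?(negPf ij) ?(negPf ik) // eq_sym.
by rewrite imsetU1 imset_set1.
Qed.

Lemma xU i : x i \in U.
Proof. by rewrite inE imset_f. Qed.

Lemma yU i : y i \in U.
Proof. by rewrite inE orbC imset_f. Qed.

Lemma UP u : u \in U -> (exists i, u = x i) \/ (exists i, u = y i).
Proof. by case/setUP => /imsetP[i _ ->]; [left|right]; exists i. Qed.

Lemma card_U : #|U| = 6.
Proof.
rewrite cardsU disjoint_setI0 ?cards0 ?card_imset ?card_ord //.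
rewrite disjoints_subset; apply/subsetP => u /imsetP[i _ ->]; rewrite inE.
by apply/imsetP => -[j _ /eqP]; rewrite vertexE.
Qed.

Lemma sub_coreU i : core i \subset U.
Proof. by apply/subsetP => u /imsetP[j _ ->]; apply: xU. Qed.

Lemma sub_triU i : y i |: core i \subset U.
Proof. by rewrite subUset sub1set yU sub_coreU. Qed.

Lemma outsideE w : w \notin U ->
  ((forall i, (w == x i) = false) * (forall i, (w == y i) = false) *
   (forall i, (x i == w) = false) * (forall i, (y i == w) = false) *
   (forall i, (w \in core i) = false))%type.
Proof.
move=> wU; have wx i : (w == x i) = false.
  by apply: contraNF wU => /eqP ->; apply: xU.
have wy i : (w == y i) = false by apply: contraNF wU => /eqP ->; apply: yU.
do ![split] => i //; rewrite 1?eq_sym //.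
by apply: contraNF wU; apply: subsetP (sub_coreU i) w.
Qed.

Lemma tri_edge i j k : uniq [:: i; j; k] ->
  [/\ [set y i; x j; x k] \in E, [set x j; x k; y i] \in E
    & [set x j; y i; x k] \in E].
Proof.
move=> u; have := tri i; rewrite (coreE u) setUA => T; split=> //.
  by rewrite -set3_rot.
by rewrite setUAC -set3_rot.
Qed.

Lemma bridge e1 e3 p q z :
  e1 \in E -> e3 \in E -> [set p; q; z] \in E ->
  ~~ [&& [disjoint e1 & e3], p \in e1, q \in e3, z \notin e1 & z \notin e3].
Proof.
move=> h1 h3 h2; apply/negP => /and5P[d pe qe z1 z3].
by have := free_bridge Hfree h1 h3 d pe qe z1 z3; rewrite h2.
Qed.

(** Otherwise the edge continues to a linear path with two edges of the
    triangle, the second of them disjoint from it; this covers an edge with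
    one vertex in U, and the pairs {x_i, y_j} and {y_i, y_j}. *)
Lemma edge_leaving e w : e \in E -> ~~ [disjoint e & U] -> w \in e -> w \notin U ->
  exists i, e = w |: core i \/ e = w |: spike i.
Proof.
move=> eE /pred0Pn[u /andP[/= ue uU]] we wU.
have uw : u != w by apply: contraNneq wU => <-.
have [v [Ee vu vw]] := card3_set3 (card_edge eE) ue we uw.
have [vU|vU] := boolP (v \in U); last first.
  case: (UP uU) => -[i ui]; subst u; have [j [k ijk]] := index_rest i;
    have [jik jki] := uniq_index_perm ijk; have [kji kij] := uniq_index_perm jki.
  - have [_ mid _] := tri_edge kij; have := bridge eE (tri i) mid.
    by rewrite Ee disjoint_set3 !inE !vertexE !(outsideE vU) !(outsideE wU)
      ?(index_neqE ijk) ?eqxx.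
  - have [mid _ _] := tri_edge ijk; have := bridge eE (tri k) mid.
    by rewrite Ee disjoint_set3 !inE !vertexE !(outsideE vU) !(outsideE wU)
      ?(index_neqE ijk) ?eqxx.
case: (UP uU) (UP vU) => -[i ui] [] [j vj]; subst u v.
- rewrite vertexE in vu; have [k jik] := third_index vu; exists k; left.
  have [ijk ikj] := uniq_index_perm jik; have [kij _] := uniq_index_perm ikj.
  by rewrite Ee (coreE kij) setUA set3_rot setUAC.
- have [ij|ij] := eqVneq i j; first
    by exists j; right; rewrite Ee ij setUA set3_rot setUAC.
  have [k ijk] := third_index ij; have [jik jki] := uniq_index_perm ijk.
  have [kji kij] := uniq_index_perm jki; have [_ mid _] := tri_edge kij.
  have := bridge eE (tri i) mid.
  by rewrite Ee disjoint_set3 !inE !vertexE !(outsideE wU) ?(index_neqE ijk) ?eqxx.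
- have [ij|ij] := eqVneq i j; first by exists j; right; rewrite Ee ij setUA set3_rot.
  have [k ijk] := third_index ij; have [jik jki] := uniq_index_perm ijk.
  have [kji kij] := uniq_index_perm jki; have [_ mid _] := tri_edge kji.
  have := bridge eE (tri j) mid.
  by rewrite Ee disjoint_set3 !inE !vertexE !(outsideE wU) ?(index_neqE ijk) ?eqxx.
- rewrite vertexE in vu; have [k jik] := third_index vu.
  have [ijk ikj] := uniq_index_perm jik; have [mid _ _] := tri_edge ijk.
  have := bridge eE (tri k) mid.
  by rewrite Ee disjoint_set3 !inE !vertexE !(outsideE wU) ?(index_neqE ijk) ?eqxx.
Qed.

(** An edge f meeting U is {w} with a core pair or a spike, and some edge of
    the triangle meets such a pair in exactly one vertex: if an edge e disjoint
    from U contained w, then e, f and that edge would form a linear path. *)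
Lemma edge_meets_U e f w : e \in E -> f \in E -> w \in e -> w \in f ->
  [disjoint e & U] -> [disjoint f & U].
Proof.
move=> eE fE we wf eU; apply: contraTT isT => fU.
have wU : w \notin U by rewrite (disjointFr eU we).
have eu u : u \in U -> (u \in e) = false by apply: disjointFl eU.
have ds k : [disjoint e & y k |: core k] by apply: disjointWr (sub_triU k) eU.
have [i fi] := edge_leaving fE fU wf wU.
have [j [k ijk]] := index_rest i; have [jik jki] := uniq_index_perm ijk.
case: fi => fi; rewrite fi in fE.
- rewrite (coreE ijk) setUA in fE; have := bridge eE (tri k) fE.
  by rewrite ds we !inE !vertexE !eu ?xU // !(index_neqE ijk) ?eqxx.
- rewrite /spike_pair setUA in fE; have := bridge eE (tri j) fE.
  by rewrite ds we !inE !vertexE !eu ?yU // !(index_neqE ijk) ?eqxx.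
Qed.

Lemma core_edge w i j k : uniq [:: i; j; k] -> i \in cores w -> [set w; x j; x k] \in E.
Proof. by move=> ijk; rewrite inE (coreE ijk) setUA. Qed.

Lemma spike_edge w i : i \in spikes w -> [set w; x i; y i] \in E.
Proof. by rewrite inE /spike_pair setUA. Qed.

(** * Pairs at different outer vertices *)

(** Two disjoint spikes are joined by the triangle edge through their core
    vertices. *)
Lemma spike_spike w w' i j : w \notin U -> w' \notin U -> w != w' ->
  i \in spikes w -> j \in spikes w' -> i = j.
Proof.
move=> wU wU' ww' /spike_edge iB /spike_edge jB; apply/eqP; apply: contraTT isT => ij.
have [k ijk] := third_index ij; have [_ jki] := uniq_index_perm ijk.
have [_ kij] := uniq_index_perm jki; have [_ mid _] := tri_edge kij.
have := bridge iB jB mid.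
by rewrite disjoint_set3 !inE !vertexE !(outsideE wU) !(outsideE wU') (negPf ww')
  !(index_neqE ijk) !eqxx.
Qed.

(** The triangle edge {x_i, x_j, y_k} joins {w, x_i, y_i} to {w', x_j, x_k}. *)
Lemma spike_core w w' i : w \notin U -> w' \notin U -> w != w' ->
  i \in spikes w -> i \notin cores w'.
Proof.
move=> wU wU' ww' /spike_edge iB; apply/negP => iA.
have [j [k ijk]] := index_rest i; have [_ jki] := uniq_index_perm ijk.
have [_ kij] := uniq_index_perm jki; have [_ mid _] := tri_edge kij.
have := bridge iB (core_edge ijk iA) mid.
by rewrite disjoint_set3 !inE !vertexE !(outsideE wU) !(outsideE wU') (negPf ww')
  !(index_neqE ijk) !eqxx.
Qed.

(** * Edges inside the triangle *)

(** Otherwise {w, p, q} bridges the disjoint edges e and U \ e. *)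
Lemma complement_split w p q e : w \notin U -> p \in U -> q \in U ->
  [set w; p; q] \in E -> e \in E -> e \subset U -> U :\: e \in E ->
  (p \in e) = (q \in e).
Proof.
move=> wU; wlog: p q / p \in e => [W|pe] pU qU h eE eU ceE.
  have [pe|pe] := boolP (p \in e); first by rewrite -(W p q) // pe.
  have [qe|//] := boolP (q \in e).
  by rewrite setUAC in h; have := W q p qe qU pU h eE eU ceE; rewrite (negPf pe) qe.
rewrite pe; apply/esym; apply: contraTT isT => qe.
have d : [disjoint e & U :\: e].
  by rewrite disjoints_subset; apply/subsetP => u ue; rewrite !inE ue.
rewrite set3_rot in h; have := bridge eE ceE h.
by rewrite d pe !in_setD qU qe (negPf wU) andbF (contra (subsetP eU w)).
Qed.

(** Let z be the third vertex of e.  If z is not y_i, an edge of the triangle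
    contains z, one vertex of {x_j, x_k} and a vertex outside e, and so bridges
    {w, x_j, x_k} and U \ e. *)
Lemma half_core w i j k (e : {set V}) : uniq [:: i; j; k] -> w \notin U -> i \in cores w ->
  #|e| = 3 -> e \subset U -> U :\: e \in E -> x j \in e -> x k \in e ->
  e = y i |: core i.
Proof.
move=> ijk wU iA e3 eU ceE je ke; have [_ jki] := uniq_index_perm ijk.
have [kji _] := uniq_index_perm jki.
have [|z [Ee zj zk]] := card3_set3 e3 je ke; first by rewrite vertexE (index_neqE ijk).
have : z \in U by apply: (subsetP eU); rewrite Ee !inE eqxx orbT.
have hA := core_edge ijk iA.
case/UP => -[l zl]; subst z.
- rewrite !vertexE in zj zk; have li : l = i.
    by case: (index_cases l ijk) zj zk => // ->; rewrite eqxx.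
  subst l; have [_ _ mid] := tri_edge kji.
  have := bridge hA ceE mid.
  by rewrite disjoint_set3 !in_setD !xU !yU (negPf wU) Ee !inE !vertexE
     ?(outsideE wU) !(index_neqE ijk) !eqxx.
- case: (index_cases l ijk) => li; subst l.
  + by rewrite Ee (coreE ijk) setUA -set3_rot.
  + have [_ mid _] := tri_edge jki; have := bridge hA ceE mid.
    rewrite disjoint_set3 !in_setD !xU !yU (negPf wU) Ee !inE !vertexE.
    by rewrite ?(outsideE wU) !(index_neqE ijk) !eqxx.
  + have [_ mid _] := tri_edge kji; have := bridge hA ceE mid.
    rewrite disjoint_set3 !in_setD !xU !yU (negPf wU) Ee !inE !vertexE.
    by rewrite ?(outsideE wU) !(index_neqE ijk) !eqxx.
Qed.

(** As in [half_core]: for every third vertex z, an edge of the triangle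
    contains z, one vertex of {x_i, y_i} and a vertex outside e. *)
Lemma half_spike w i (e : {set V}) : w \notin U -> i \in spikes w ->
  #|e| = 3 -> e \subset U -> U :\: e \in E -> x i \in e -> y i \notin e.
Proof.
move=> wU iB e3 eU ceE xe; apply/negP => ye.
have [//|z [Ee zx zy]] := card3_set3 e3 xe ye.
have : z \in U by apply: (subsetP eU); rewrite Ee !inE eqxx orbT.
have hB := spike_edge iB.
case/UP => -[l zl]; subst z; rewrite ?vertexE in zx zy.
- have [k lik] := third_index zx; have [_ ikl] := uniq_index_perm lik.
  have [_ _ mid] := tri_edge (uniq_index_perm ikl).1.
  have := bridge hB ceE mid.
  rewrite disjoint_set3 !in_setD !xU !yU (negPf wU) Ee !inE !vertexE.
  by rewrite ?(outsideE wU) !(index_neqE lik) !eqxx.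
- have [k lik] := third_index zy; have [_ mid _] := tri_edge lik.
  have := bridge hB ceE mid.
  rewrite disjoint_set3 !in_setD !xU !yU (negPf wU) Ee !inE !vertexE.
  by rewrite ?(outsideE wU) !(index_neqE lik) !eqxx.
Qed.

Lemma complK (e : {set V}) : e \subset U -> U :\: (U :\: e) = e.
Proof. by move=> eU; rewrite setDDr setDv set0U; apply/setIidPr. Qed.

Lemma complementary_spike w i e : w \notin U -> i \in spikes w ->
  e \in E -> e \subset U -> U :\: e \notin E.
Proof.
move=> wU iB eE eU; apply/negP => ceE; have ceU : U :\: e \subset U := subsetDl _ _.
have cce := complK eU.
have s := complement_split wU (xU i) (yU i) (spike_edge iB) eE eU ceE.
have [xe|xe] := boolP (x i \in e).
  by have := half_spike wU iB (card_edge eE) eU ceE xe; rewrite -s xe.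
have := half_spike wU iB (card_edge ceE) ceU.
by rewrite cce !in_setD -s xe xU yU => /(_ eE isT).
Qed.

(** By [complement_split] one of the two complementary edges contains both x_j
    and x_k, and [half_core] identifies it. *)
Lemma complementary_core w i e : w \notin U -> i \in cores w ->
  e \in E -> e \subset U -> U :\: e \in E ->
  e = y i |: core i \/ U :\: e = y i |: core i.
Proof.
move=> wU iA eE eU ceE; have ceU : U :\: e \subset U := subsetDl _ _.
have cce := complK eU.
have [j [k ijk]] := index_rest i.
have s := complement_split wU (xU j) (xU k) (core_edge ijk iA) eE eU ceE.
have [xe|xe] := boolP (x j \in e); [left|right].
  by apply: (half_core ijk wU iA (card_edge eE)); rewrite // -s.
apply: (half_core ijk wU iA (card_edge ceE)); rewrite ?cce // in_setD xU andbT //.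
by rewrite -s.
Qed.

Let EU := [set e in E | e \subset U].
Let compl (e : {set V}) := U :\: e.

(** The inner edges and their complements are among the 20 triples of U, and
    they overlap exactly in the complementary pairs of inner edges. *)
Lemma card_inner : 2 * #|EU| <= 20 + #|EU :&: compl @: EU|.
Proof.
have sub e : e \in EU -> e \in [set e : {set V} | e \subset U & #|e| == 3].
  by rewrite !inE => /andP[/card_edge -> ->].
have cK : {in EU, cancel compl compl}.
  move=> e /sub; rewrite inE => /andP[eU _].
  exact: complK.
have <- : #|[set e : {set V} | e \subset U & #|e| == 3]| = 20.
  by rewrite cards_draws card_U.
have cI : #|compl @: EU| = #|EU| by apply/card_in_imset/(can_in_inj cK).
rewrite mul2n -addnn -{2}cI -cardsUI leq_add2r; apply/subset_leq_card.
rewrite subUset; apply/andP; split; first exact/subsetP.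
apply/subsetP => _ /imsetP[e /sub + ->]; rewrite !inE subsetDl => /andP[eU /eqP e3].
by rewrite cardsD card_U (setIidPr eU) e3.
Qed.

Lemma inner_edgeP e : e \in EU :&: compl @: EU ->
  [/\ e \in E, e \subset U & U :\: e \in E].
Proof.
rewrite !inE => /andP[/andP[eE eU] /imsetP[f]]; rewrite inE => /andP[fE fU] ef.
by split=> //; rewrite ef /compl complK.
Qed.

Lemma inner_spike w i : w \notin U -> i \in spikes w -> #|EU| <= 10.
Proof.
move=> wU iB; have := card_inner; suff -> : EU :&: compl @: EU = set0.
  by rewrite cards0; lia.
apply/setP => e; rewrite in_set0; apply/negP => /inner_edgeP[eE eU ceE].
by have := complementary_spike wU iB eE eU; rewrite ceE.
Qed.

Lemma inner_core w i : w \notin U -> i \in cores w -> #|EU| <= 11.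
Proof.
move=> wU iA; have := card_inner.
suff : #|EU :&: compl @: EU| <= 2 by lia.
apply: (@leq_trans #|[set y i |: core i; compl (y i |: core i)]|); last first.
  by rewrite cards2; case: (_ != _).
apply/subset_leq_card/subsetP => e /inner_edgeP[eE eU ceE]; rewrite !inE.
have [->|h] := complementary_core wU iA eE eU ceE; first by rewrite eqxx.
by rewrite -h /compl complK // eqxx orbT.
Qed.

(** The exceptional pairs {T_i, U \ T_i} and {T_j, U \ T_j} are different, as
    T_i and T_j are distinct and share x_k. *)
Lemma inner_two_cores w w' i j : w \notin U -> w' \notin U ->
  i \in cores w -> j \in cores w' -> i != j -> #|EU| <= 10.
Proof.
move=> wU wU' iA jA ij; have := card_inner.
suff -> : EU :&: compl @: EU = set0 by rewrite cards0; lia.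
apply/setP => e; rewrite in_set0; apply/negP => /inner_edgeP[eE eU ceE].
have [k ijk] := third_index ij.
have kT l : (l != k) -> x k \in y l |: core l by rewrite !inE !vertexE eq_sym.
have kie := kT i; have kje := kT j; rewrite !(index_neqE ijk) in kie kje.
have yT : y i \notin y j |: core j by rewrite !inE !vertexE (index_neqE ijk).
have yTi : y i \in y i |: core i by rewrite setU11.
case: (complementary_core wU iA eE eU ceE) => hi;
  case: (complementary_core wU' jA eE eU ceE) => hj.
- by rewrite -hj hi yTi in yT.
- by have := kje isT; rewrite -hj hi inE kie.
- by have := kie isT; rewrite -hi hj inE kje.
- by rewrite -hj hi yTi in yT.
Qed.

(** * Counting *)

Let deg w := #|cores w| + #|spikes w|.

(** A vertex w with more than three pairs has two spikes, or one spike and all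
    three core pairs; either way no spike is possible at w', and each spike at
    w forbids one core pair at w'. *)
Lemma outer_other w w' : w \notin U -> w' \notin U -> w != w' -> 3 < deg w ->
  deg w' <= 3 - #|spikes w|.
Proof.
move=> wU wU' ww' dw; have w'w : w' != w by rewrite eq_sym.
have Aw' : #|cores w'| <= #|~: spikes w|.
  apply/subset_leq_card/subsetP => i iA; rewrite inE; apply: contraL iA.
  exact: spike_core wU wU' ww'.
have Bw' : spikes w' = set0.
  apply/setP => j; rewrite [RHS]in_set0; apply/negP => jB; move: dw; apply/negP.
  have : #|spikes w| <= 1.
    apply/card_le1_eqP => i i' iB iB'.
    by rewrite (spike_spike wU wU' ww' iB jB) (spike_spike wU wU' ww' iB' jB).
  have : #|cores w| <= #|[set~ j]|.
    apply/subset_leq_card/subsetP => i; rewrite !inE; apply: contraTneq => ->.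
    by have := spike_core wU' wU w'w jB; rewrite inE.
  by rewrite cardsC1 card_ord /deg; lia.
have := cardsC (spikes w); rewrite card_ord /deg Bw' cards0; lia.
Qed.

(** If w carries b spikes and more than three pairs, the sum is at most
    (3 + b) + (3 - b) (|W| - 1), which is at most 3 |W| once |W| >= 2. *)
Lemma outer_sum : 1 < #|~: U| -> \sum_(w in ~: U) deg w <= 3 * #|~: U|.
Proof.
have le3 (X : {set 'I_3}) : #|X| <= 3 by have := max_card X; rewrite card_ord.
move=> W2; have [/exists_inP[w wU dw]|] := boolP [exists w in ~: U, 3 < deg w].
  rewrite (big_setD1 w) //=.
  have : \sum_(v in ~: U :\ w) deg v <= \sum_(v in ~: U :\ w) (3 - #|spikes w|).
    apply: leq_sum => v; rewrite in_setD1 => /andP[vw vU].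
    by rewrite !in_setC in wU vU; apply: outer_other; rewrite // eq_sym.
  rewrite sum_nat_const; have := cardsD1 w (~: U); rewrite wU add1n.
  move: W2 (le3 (cores w)) (le3 (spikes w)).
  have -> : deg w = #|cores w| + #|spikes w| by [].
  move: #|~: U| #|~: U :\ w| #|cores w| #|spikes w| (\sum_(_ in _) _) => N N' a b s.
  by case: b => [|[|[|[]]]] //; lia.
rewrite negb_exists_in => /forall_inP h; rewrite mulnC -sum_nat_const.
by apply: leq_sum => w /h; rewrite -leqNgt.
Qed.

Hypothesis Hconn : connected H.

(** The union S of U and of all edges meeting U is closed under adjacency by
    [edge_meets_U], so it is everything. *)
Lemma meeting_cover v :
  v \in U \/ exists2 f, f \in E & (v \in f) && ~~ [disjoint f & U].
Proof.
pose S := U :|: \bigcup_(f in E | ~~ [disjoint f & U]) f.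
have subS f : f \in E -> ~~ [disjoint f & U] -> f \subset S.
  move=> fE fU; apply/subsetU; apply/orP; right.
  by apply: (bigcup_sup f); rewrite ?fE.
have : ~: S == set0.
  have := existsPn Hconn S; rewrite !negb_and !negbK => /or3P[|//|].
    by move/eqP/setP/(_ (x ord0)); rewrite in_set0 in_setU xU.
  case/forall_inPn => e eE; rewrite negb_or => /andP[eS eCS].
  have [eU|eU] := boolP [disjoint e & U]; last by rewrite subS in eS.
  case/negP: eCS; apply/subsetP => u ue; rewrite in_setC in_setU (disjointFr eU ue) /=.
  apply/bigcupP => -[f /andP[fE fU] uf].
  by rewrite (edge_meets_U eE fE ue uf eU) in fU.
move/eqP/setP/(_ v); rewrite in_set0 in_setC => /negbFE.
by case/setUP => [|/bigcupP[f /andP[fE fU] vf]]; [left|right; exists f; rewrite ?vf].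
Qed.

Lemma edge_meets e : e \in E -> ~~ [disjoint e & U].
Proof.
move=> eE; apply/negP => eU.
have /card_gt0P[v ve] : 0 < #|e| by rewrite (card_edge eE).
have [vU|[f fE /andP[vf]]] := meeting_cover v; first by rewrite (disjointFr eU ve) in vU.
by rewrite (edge_meets_U eE fE ve vf eU).
Qed.

Lemma edges_split :
  E \subset EU :|: \bigcup_(w in ~: U)
     ([set w |: core i | i in cores w] :|: [set w |: spike i | i in spikes w]).
Proof.
apply/subsetP => e eE; rewrite in_setU inE eE /=.
have [//|/subsetPn[w we wU] /=] := boolP (e \subset U).
have [i ei] := edge_leaving eE (edge_meets eE) we wU.
apply/bigcupP; exists w; first by rewrite inE.
by case: ei => ei; apply/setUP; [left|right];
  apply/imsetP; exists i; rewrite // inE -ei.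
Qed.

Lemma card_edges_le : #|E| <= #|EU| + \sum_(w in ~: U) deg w.
Proof.
apply: leq_trans (subset_leq_card edges_split) _.
apply: leq_trans (leq_card_setU _ _) _; rewrite leq_add2l.
elim/big_rec2: _ => [|w n X _ le]; first by rewrite cards0.
apply: leq_trans (leq_card_setU _ _) _; apply: leq_add le.
by apply: leq_trans (leq_card_setU _ _) _; apply: leq_add; apply: leq_imset_card.
Qed.

Lemma link_nonempty w : w \notin U -> exists i, (i \in cores w) || (i \in spikes w).
Proof.
move=> wU; have [|[f fE /andP[wf fU]]] := meeting_cover w; first by rewrite (negPf wU).
have [i fi] := edge_leaving fE fU wf wU.
by exists i; rewrite !inE; case: fi => <-; rewrite fE ?orbT.
Qed.

Lemma card_edges_bound : 9 <= #|V| -> #|E| <= 3 * #|V| - 8.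
Proof.
move=> V9; have := cardsC U; rewrite card_U => cW; apply: leq_trans card_edges_le _.
have le_sum : \sum_(w in ~: U) deg w <= 3 * #|~: U| by apply: outer_sum; lia.
have [inner|inner] := leqP #|EU| 10; first lia.
have noB w : w \notin U -> spikes w = set0.
  move=> wU; apply/setP => i; rewrite [RHS]in_set0; apply/negP => iB.
  by have := inner_spike wU iB; rewrite leqNgt inner.
have /card_gt0P[w] : 0 < #|~: U| by lia.
rewrite in_setC => wU; have [i] := link_nonempty wU.
rewrite (noB w) // in_set0 orbF => iA.
have : \sum_(v in ~: U) deg v <= \sum_(v in ~: U) 1.
  apply: leq_sum => v; rewrite in_setC => vU; rewrite /deg noB // cards0 addn0.
  apply/card_le1_eqP; suff oneA j : j \in cores v -> j = i by move=> j k /oneA-> /oneA->.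
  move=> jA; apply/eqP; apply: contraLR inner => ji; rewrite -leqNgt.
  exact: inner_two_cores vU wU jA iA ji.
rewrite sum1_card; have := inner_core wU iA; lia.
Qed.

End Triangle.

(** * Reading off the triangle *)

Lemma eq_triple n i j k i' j' k' :
  perm_eq [:: i; j; k] [:: i'; j'; k'] -> triple n i j k = triple n i' j' k'.
Proof. by move=> /perm_mem eqm; apply/setP => z; rewrite !inE -!mem_seq3 -eqm. Qed.

Lemma C33_edge i j k :
  has (perm_eq [:: i; j; k]) [:: [:: 0; 1; 2]; [:: 2; 3; 4]; [:: 4; 5; 0]] ->
  triple 6 i j k \in edges C33.
Proof.
rewrite /= orbF !inE -orbA.
by case/or3P => /(@eq_triple 6) ->; rewrite eqxx ?orbT.
Qed.

Lemma card_edges_connected_free (V : finType) (H : tgraph V) :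
  9 <= #|V| -> connected H -> free P33 H -> contains C33 H ->
  #|edges H| <= 3 * #|V| - 8.
Proof.
move=> V9 Hc Hf /existsP[f /andP[/injectiveP f_inj /forall_inP fE]].
have ltx (i : 'I_3) : 2 * i < 6 by have := ltn_ord i; lia.
have lty (i : 'I_3) : (2 * i + 3) %% 6 < 6 by rewrite ltn_mod.
(* The corners are 0, 2, 4; the edge 012, 234 or 450 avoiding 2 i has middle
   vertex 2 i + 3 modulo 6. *)
pose x i := f (Ordinal (ltx i)); pose y i := f (Ordinal (lty i)).
apply: (@card_edges_bound V H x y) => //.
- by move=> i j /f_inj/(congr1 val)/= ij; apply/val_inj => /=; lia.
- move=> i j /f_inj/(congr1 val)/= ij; apply/val_inj => /=.
  by have := ltn_ord i; have := ltn_ord j; lia.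
- by move=> i j; apply/eqP => /f_inj/(congr1 val)/=; lia.
move=> i; have [j [k ijk]] := index_rest i.
rewrite (coreE _ ijk) setUA -imset_triple; apply: fE.
apply: C33_edge; move: i j k ijk {ltx lty x y}.
by move=> [[|[|[|//]]] ?] [[|[|[|//]]] ?] [[|[|[|//]]] ?].
Qed.

(** * The extremal 3-graph *)

Section Extremal.

Variables (n : nat) (n9 : 9 <= n).
Let K := triple n 0 1 2.

Definition two_core_edges : {set {set 'I_n}} :=
  [set e : {set 'I_n} | (#|e| == 3) && (2 <= #|e :&: triple n 0 1 2|)].

Lemma two_core_uniform : [forall e in two_core_edges, #|e| == 3].
Proof. by apply/forall_inP => e; rewrite inE => /andP[]. Qed.

Definition two_core : tgraph 'I_n := TGraph two_core_uniform.

Lemma card_K : #|K| = 3.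
Proof. by apply/eqP/card_triple => //; lia. Qed.

Lemma two_core_edgeP (u v w : 'I_n) : u \in K -> v \in K -> uniq [:: u; v; w] ->
  [set u; v; w] \in edges two_core.
Proof.
rewrite /= !inE negb_or andbT => uK vK /andP[/andP[uv uw] vw].
rewrite -setUA cardsU1 cards2 !inE negb_or uv uw vw /=.
apply: (@leq_trans #|[set u; v]|); first by rewrite cards2 uv.
apply/subset_leq_card/subsetP => z; rewrite !inE.
by case/orP => /eqP ->; rewrite eqxx ?orbT.
Qed.

Lemma two_core_connected : connected two_core.
Proof.
have n0 : 0 < n by lia. have n1 : 1 < n by lia. have n2 : 2 < n by lia.
pose a := Ordinal n0; pose b := Ordinal n1; pose c := Ordinal n2.
(* Every vertex shares an edge with a, so a vertex on the other side of a cut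
   gives an edge crossing it. *)
have join v : v != a -> exists2 e, e \in edges two_core & (a \in e) && (v \in e).
  move=> va; have [vb|vb] := eqVneq v b.
    exists [set a; b; c]; last by rewrite vb !inE !eqxx.
    by apply: two_core_edgeP; rewrite // inE.
  exists [set a; b; v]; last by rewrite !inE !eqxx orbT.
  by apply: two_core_edgeP; rewrite ?inE //= !inE ![_ == v]eq_sym (negPf va) (negPf vb).
apply/existsPn => X; rewrite !negb_and !negbK.
have [aX|aX] := boolP (a \in X).
- have [vX|] := boolP (~: X == set0); first by rewrite orbT.
  case/set0Pn => v; rewrite in_setC => vX.
  have [|e eE /andP[ae ve]] := join v; first by apply: contraNneq vX => ->.
  apply/or3P/Or33/forall_inPn; exists e => //; rewrite negb_or.
  apply/andP; split; apply/subsetPn; [exists v | exists a] => //.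
  by rewrite inE negbK.
- have [vX|] := boolP (X == set0); first by [].
  case/set0Pn => v vX.
  have [|e eE /andP[ae ve]] := join v; first by apply: contraNneq aX => <-.
  apply/or3P/Or33/forall_inPn; exists e => //; rewrite negb_or.
  apply/andP; split; apply/subsetPn; [exists a | exists v] => //.
  by rewrite inE negbK.
Qed.

(** The first and the last edge of a linear path are disjoint, but each has two
    of the three vertices of K. *)
Lemma two_core_free : free P33 two_core.
Proof.
apply/existsPn => f; apply/negP => /andP[/injectiveP f_inj /forall_inP fE].
have h1 : f @: triple 7 0 1 2 \in edges two_core by apply: fE; rewrite !inE eqxx.
have h3 : f @: triple 7 4 5 6 \in edges two_core by apply: fE; rewrite !inE eqxx ?orbT.
move: h1 h3; rewrite !inE -/K => /andP[_ h1] /andP[_ h3].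
have : #|(f @: triple 7 0 1 2 :&: K) :|: (f @: triple 7 4 5 6 :&: K)| <= #|K|.
  by apply: subset_leq_card; rewrite subUset !subsetIr.
rewrite card_K cardsU -!setIA (setIC K) -setIA setIid setIA.
have -> : f @: triple 7 0 1 2 :&: f @: triple 7 4 5 6 = set0.
  rewrite -imsetI; last by move=> ? ? _ _; apply: f_inj.
  suff -> : triple 7 0 1 2 :&: triple 7 4 5 6 = set0 by rewrite imset0.
  by apply/setP => z; rewrite !inE; case: z => -[|[|[|[|]]]].
by rewrite set0I cards0 subn0; lia.
Qed.

Lemma two_core_contains : contains C33 two_core.
Proof.
(* Corners go to K = {0, 1, 2}, the middle vertices to 3, 4, 5. *)
pose s := [:: 0; 3; 1; 4; 2; 5].
have lts (i : 'I_6) : nth 0 s i < n.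
  by apply: leq_trans n9; have /all_nthP := (isT : all (ltn^~ 9) s); apply.
pose f := [ffun i => Ordinal (lts i)].
have f_inj : injective f.
  move=> i j /(congr1 val); rewrite !ffunE => /eqP /=.
  by rewrite nth_uniq // => /eqP/val_inj.
apply/existsP; exists f; apply/andP; split; first exact/injectiveP.
apply/forall_inP => e /setUP[/set2P[]|/set1P] ->.
all: rewrite imset_triple // => *; rewrite setUAC.
all: apply: two_core_edgeP; rewrite ?inE ?ffunE //=.
all: by rewrite !inE !(inj_eq f_inj).
Qed.

(** Besides K itself, the edges are K with one vertex k replaced by an outside
    vertex v. *)
Lemma two_core_card : 3 * n - 8 <= #|edges two_core|.
Proof.
pose F (p : 'I_n * 'I_n) := p.2 |: (K :\ p.1).
have F_inj : {in setX K (~: K) &, injective F}.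
  move=> [k v] [k' v'] /setXP[/= kK +] /setXP[/= k'K +] /setP FF.
  rewrite !in_setC => vK v'K; congr pair; apply/eqP.
    have := FF k; rewrite !in_setU1 !in_setD1 eqxx kK /= !andbT orbF.
    case: (k == k') => //.
    by rewrite orbT => /eqP kv; rewrite -kv kK in vK.
  have := FF v; rewrite !in_setU1 !in_setD1 eqxx (negPf vK) !andbF !orbF /=.
  by move=> <-.
have KF : K \notin F @: setX K (~: K).
  apply/imsetP => -[[k v] /setXP[/= _ vK] KE].
  by rewrite in_setC {1}KE setU11 in vK.
have <- : #|K |: F @: setX K (~: K)| = 3 * n - 8.
  rewrite cardsU1 KF card_in_imset // cardsX card_K /=.
  by have := cardsC K; rewrite card_K card_ord; move: #|_| => m; lia.
apply/subset_leq_card/subsetP => e /setU1P[->|/imsetP[[k v] /setXP[/= kK vK] ->]].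
  by rewrite inE -/K setIid card_K.
rewrite in_setC in vK; have K2 : #|K :\ k| = 2.
  by have := cardsD1 k K; rewrite kK card_K add1n => -[].
rewrite inE cardsU1 in_setD1 (negPf vK) andbF K2 /=.
rewrite -{1}K2; apply/subset_leq_card/subsetP => u uK.
by rewrite in_setI in_setU1 uK orbT; apply: subsetP (subsetDl _ _) u uK.
Qed.

End Extremal.

Theorem corollary2 (n : nat) (hn : 9 <= n) : ex_con n P33 C33 = 3 * n - 8.
Proof.
apply/eqP; rewrite eqn_leq; apply/andP; split.
  apply/bigmax_leqP => H /and3P[Hc Hf HC].
  by have := card_edges_connected_free _ Hc Hf HC; rewrite card_ord; apply.
apply: leq_trans (two_core_card hn) _.
apply: (leq_bigmax_cond (two_core n)).
by rewrite two_core_connected ?two_core_free ?two_core_contains.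
Qed.
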